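(* Let $u(n,k)$, $v(n,k)$ ($n\ge 0,k\ge 1$) be complex numbers with $v(n,k)\ne 0$ for all $n,k$, let $(a_n)_{n\ge0}$ be a complex sequence, let $M(u,v,a)=(a_n^k)$ be defined by $a_n^0=a_n$ and $a_n^k=u(n,k)a_n^{k-1}+v(n,k)a_{n+1}^{k-1}$ ($n\ge0,k\ge1$), and let $R=(r_{k,\ell})_{k,\ell\ge0}$ be the matrix associated to column $0$ of $M(u,v,a)$. Then the matrix associated to column $0$ of the transpose ${}^tM(u,v,a)$ is the inverse $R^{-1}$. That is, as identities of formal power series: (i) If there are formal power series $g,f$ with $g(0)=1$, $f(0)=0$, $f'(0)\ne0$ such that $\sum_{k\ge0} r_{k,\ell}\,t^k=w_\ell\, g(t)\,f(t)^\ell$ for all $\ell\ge 0$, where either $w_\ell=1$ for all $\ell$ or $w_\ell=\frac1{\ell!}$ for all $\ell$, then $$\frac{1}{g(\bar f(t))}\,\bar a(\bar f(t))=\begin{cases} a(t) & \text{if } w_\ell=1 \text{ for all }\ell,\\ A(t) & \text{if } w_\ell=\frac1{\ell!}\text{ for all }\ell.\end{cases}$$ (ii) If there are formal power series $G,F$ with $G(0)=1$, $F(0)=0$, $F'(0)\neq 0$ such that $\sum_{k\ge0} r_{k,\ell}\,\frac{t^k}{k!}=w_\ell\, G(t)\,\frac{F(t)^\ell}{\ell!}$ for all $\ell\ge 0$, where either $w_\ell=1$ for all $\ell$ or $w_\ell=\ell!$ for all $\ell$, then $$\frac{1}{G(\bar F(t))}\,\bar A(\bar F(t))=\begin{cases}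 A(t) & \text{if } w_\ell=1\text{ for all }\ell,\\ a(t) & \text{if } w_\ell=\ell!\text{ for all }\ell.\end{cases}$$
   Context: Superscripts in $a_n^k$ are indices (row $k$, column $n$). The matrix associated to column $0$ of $M(u,v,a)$ is the lower triangular matrix $R=C_0=(C_0(k,\ell))_{k,\ell\ge 0}$, where $$C_n(k,\ell)=\sum_{\substack{A\subset[k]\\ |A|=k-\ell}}\ \prod_{i=0}^{k-\ell-1} u(n+k-h_i-i,\,h_i)\ \prod_{j=0}^{\ell-1} v(n+j,\,m_j),$$ $[k]=\{1,\dots,k\}$, $h_0>\dots>h_{k-\ell-1}$ are the elements of $A$ and $m_0>\dots>m_{\ell-1}$ those of $[k]\setminus A$, in decreasing order, empty products are $1$, and $C_n(k,\ell)=0$ for $\ell>k$; it satisfies $(a_0^k)_{k\ge0}=R\,(a_k^0)_{k\ge0}$ (column vectors). The transpose ${}^tM(u,v,a)=(b_n^k)$ is given by $b_n^k=a_k^n$. It is again a matrix of the same type: $b_n^k=u'(n,k)b_n^{k-1}+v'(n,k)b_{n+1}^{k-1}$ with $u'(n,k)=-\frac{u(k-1,n+1)}{v(k-1,n+1)}$ and $v'(n,k)=\frac1{v(k-1,n+1)}$, so ${}^tM(u,v,a)=M(u',v',b)$ with initial sequence $b_n=b_n^0=a_0^n$; its associated matrix to column $0$ is the matrix $C_0$ built from $u',v'$. Generating functions: $a(t)=\sum_{n\ge0} a_n^0t^n$, $A(t)=\sum_{n\ge0} a_n^0\frac{t^n}{n!}$, $\bar a(t)=\sum_{n\ge0}a_0^nt^n$,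 $\bar A(t)=\sum_{n\ge0}a_0^n\frac{t^n}{n!}$. For a power series $f$ with $f(0)=0$, $f'(0)\ne0$, $\bar f$ denotes its compositional inverse: $f(\bar f(t))=\bar f(f(t))=t$ (similarly $\bar F$ for $F$). In the paper, a Riordan matrix is one whose $\ell$-th column has ordinary generating function $g(t)f(t)^\ell$ (written $(g,f)$), or, in exponential form, exponential generating function $G(t)F(t)^\ell/\ell!$ (written $[G,F]$). *)

(* Defs.v *)
From HB Require Import structures.
From mathcomp Require Import all_boot all_order all_algebra.
From mathcomp Require Import boolp classical_sets reals complex.

Set Implicit Arguments.
Unset Strict Implicit.
Unset Printing Implicit Defensive.

Import GRing.Theory.
Local Open Scope ring_scope.

Record fps (K : Type) := Fps { coef : nat -> K }.

(* [coef f n] is the coefficient of t^n in f(t), so that f(0) is [coef f 0] and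
   f'(0) is [coef f 1]. *)
Arguments coef {K} f n.
Arguments Fps {K} _.

HB.instance Definition _ (K : Type) := gen_eqMixin (fps K).
HB.instance Definition _ (K : Type) := gen_choiceMixin (fps K).

Lemma fpsP (K : Type) (f g : fps K) : coef f =1 coef g -> f = g.
Proof. by case: f g => [f] [g] /= /funext ->. Qed.

Section FpsRing.
Variable K : fieldType.
Implicit Types (f g h : fps K) (p q : {poly K}).

Definition fps_add f g := Fps (fun n => coef f n + coef g n).
Definition fps_opp f := Fps (fun n => - coef f n).
Definition fps_zero : fps K := Fps (fun=> 0).
Definition fps_one : fps K := Fps (fun n => (n == 0)%:R).
Definition fps_mul f g :=
  Fps (fun n => \sum_(i < n.+1) coef f i * coef g (n - i)).
Definition fps_scale (c : K) f := Fps (fun n => c * coef f n).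

Fact fps_addA : associative fps_add.
Proof. by move=> f g h; apply: fpsP => n /=; rewrite addrA. Qed.
Fact fps_addC : commutative fps_add.
Proof. by move=> f g; apply: fpsP => n /=; rewrite addrC. Qed.
Fact fps_add0 : left_id fps_zero fps_add.
Proof. by move=> f; apply: fpsP => n /=; rewrite add0r. Qed.
Fact fps_addN : left_inverse fps_zero fps_opp fps_add.
Proof. by move=> f; apply: fpsP => n /=; rewrite addNr. Qed.

HB.instance Definition _ :=
  GRing.isZmodule.Build (fps K) fps_addA fps_addC fps_add0 fps_addN.

Definition agree n p f := forall i, (i <= n)%N -> p`_i = coef f i.
Definition trunc n f : {poly K} := \poly_(i < n.+1) coef f i.

Lemma truncP n f : agree n (trunc n f) f.
Proof. by move=> i le_in; rewrite coef_poly ltnS le_in. Qed.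

Lemma agree_mul n p q f g :
  agree n p f -> agree n q g -> agree n (p * q) (fps_mul f g).
Proof.
move=> pf qg i le_in; rewrite coefM; apply: eq_bigr => j _.
rewrite pf ?qg //; first exact: leq_trans (leq_subr _ _) le_in.
by rewrite -ltnS (leq_trans (ltn_ord j)).
Qed.

Lemma agree_one n : agree n 1 fps_one.
Proof. by move=> i _; rewrite coef1. Qed.

Lemma agree_ext f g (P : nat -> {poly K}) :
  (forall n, agree n (P n) f) -> (forall n, agree n (P n) g) -> f = g.
Proof. by move=> Pf Pg; apply: fpsP => n; rewrite -(Pf n n) ?(Pg n n). Qed.

Fact fps_mulA : associative fps_mul.
Proof.
move=> f g h; pose P n := trunc n f * (trunc n g * trunc n h).
apply: (@agree_ext _ _ P) => n; last rewrite /P mulrA;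
  by do !apply: agree_mul; apply: truncP.
Qed.
Fact fps_mulC : commutative fps_mul.
Proof.
move=> f g; apply: (@agree_ext _ _ (fun n => trunc n f * trunc n g)) => n.
  by apply: agree_mul; apply: truncP.
by rewrite mulrC; apply: agree_mul; apply: truncP.
Qed.
Fact fps_mul1 : left_id fps_one fps_mul.
Proof.
move=> f; apply: (@agree_ext _ _ (fun n => 1 * trunc n f)) => n.
  by apply: agree_mul; [apply: agree_one | apply: truncP].
by rewrite mul1r; apply: truncP.
Qed.
Fact fps_mulD : left_distributive fps_mul +%R.
Proof.
move=> f g h; apply: fpsP => n /=; rewrite -big_split.
by apply: eq_bigr => i _; rewrite /= mulrDl.
Qed.
Fact fps_one_neq0 : fps_one != 0 :> fps K.
Proof.
by apply/eqP => /(congr1 (coef^~ 0)) /= /eqP; rewrite oner_eq0.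
Qed.

HB.instance Definition _ := GRing.Zmodule_isComNzRing.Build (fps K)
  fps_mulA fps_mulC fps_mul1 fps_mulD fps_one_neq0.

Fact fps_scaleA (c d : K) f :
  fps_scale c (fps_scale d f) = fps_scale (c * d) f.
Proof. by apply: fpsP => n /=; rewrite mulrA. Qed.
Fact fps_scale1 : left_id 1 fps_scale.
Proof. by move=> f; apply: fpsP => n /=; rewrite mul1r. Qed.
Fact fps_scaleDr : right_distributive fps_scale +%R.
Proof. by move=> c f g; apply: fpsP => n /=; rewrite mulrDr. Qed.
Fact fps_scaleDl f : {morph fps_scale^~ f : c d / c + d}.
Proof. by move=> c d; apply: fpsP => n /=; rewrite mulrDl. Qed.

HB.instance Definition _ := GRing.Zmodule_isLmodule.Build K (fps K)
  fps_scaleA fps_scale1 fps_scaleDr fps_scaleDl.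

Lemma coefD_fps f g n : coef (f + g) n = coef f n + coef g n.
Proof. by []. Qed.
Lemma coefZ_fps c f n : coef (c *: f) n = c * coef f n.
Proof. by []. Qed.
Lemma coefM_fps f g n :
  coef (f * g) n = \sum_(i < n.+1) coef f i * coef g (n - i).
Proof. by []. Qed.
Lemma coef1_fps n : coef (1 : fps K) n = (n == 0)%:R.
Proof. by []. Qed.
Lemma coef0M_fps f g : coef (f * g) 0 = coef f 0 * coef g 0.
Proof. by rewrite coefM_fps big_ord1. Qed.
Lemma coef0X_fps f n : coef (f ^+ n) 0 = coef f 0 ^+ n.
Proof. by elim: n => [|n IHn] //; rewrite !exprS coef0M_fps IHn. Qed.

Lemma course_of_values (Phi : nat -> seq K -> K) :
  exists x : nat -> K, forall n, x n = Phi n (mkseq x n).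
Proof.
pose s := fix s n := if n is m.+1 then rcons (s m) (Phi m (s m)) else [::].
exists (fun n => Phi n (s n)) => n; congr (Phi n _).
elim: n => //= n IHn.
by rewrite /mkseq -addn1 iotaD map_cat -/(mkseq _ n) -IHn /= cats1.
Qed.

Lemma fps_inv_ex f : coef f 0 != 0 -> exists h, h * f = 1.
Proof.
move=> f0; pose Phi n s :=
  ((n == 0)%:R - \sum_(i < n) nth 0 s i * coef f (n - i)) / coef f 0.
have [x xE] := course_of_values Phi; exists (Fps x); apply: fpsP => n.
rewrite coefM_fps coef1_fps big_ord_recr subnn /= [x n]xE /Phi divfK //.
rewrite addrC -[RHS]addr0 -addrA; congr (_ + _).
apply/eqP; rewrite addrC subr_eq0; apply/eqP/eq_bigr => i _.
by rewrite nth_mkseq.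
Qed.

Definition fps_unit : {pred fps K} := fun f => coef f 0 != 0.

Definition fps_inv f : fps K := xget f [set h | h * f = 1]%classic.

Fact fps_mulV : {in fps_unit, left_inverse 1 fps_inv *%R}.
Proof. by move=> f f0; have := xgetPex f (fps_inv_ex f0). Qed.
Fact fps_unitP f g : g * f = 1 -> fps_unit f.
Proof.
move=> /(congr1 (coef^~ 0)); rewrite coef0M_fps coef1_fps => gf1.
apply/negP => /eqP f0; move: gf1; rewrite f0 mulr0 => /esym/eqP.
by rewrite oner_eq0.
Qed.
Fact fps_inv_out : {in [predC fps_unit], fps_inv =1 id}.
Proof.
move=> f nf; rewrite /fps_inv; case: xgetP => // h _ /fps_unitP uf.
by case/negP: nf.
Qed.

HB.instance Definition _ := GRing.ComNzRing_hasMulInverse.Build (fps K)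
  fps_mulV fps_unitP fps_inv_out.

Lemma fps_unitE f : (f \is a GRing.unit) = (coef f 0 != 0).
Proof. by []. Qed.

Definition fpsX : fps K := Fps (fun n => (n == 1)%:R).

(* f(g(t)); the sum may be cut at k = n because this is only used when
   g(0) = 0, so that g^k has order at least k. *)
Definition fps_comp f g : fps K :=
  Fps (fun n => \sum_(k < n.+1) coef f k * coef (g ^+ k) n).

Definition is_comp_inverse f h : Prop :=
  [/\ coef h 0 = 0, fps_comp f h = fpsX & fps_comp h f = fpsX].

(* The compositional inverse; it is only meaningful under the hypotheses of
   [fps_revP] below. *)
Definition fps_rev f : fps K := xget 0 [set h | is_comp_inverse f h]%classic.

Lemma agree_exp n p f k : agree n p f -> agree n (p ^+ k) (f ^+ k).
Proof.
move=> pf; elim: k => [|k IHk]; first exact: agree_one.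
by rewrite !exprS; apply: agree_mul.
Qed.

Lemma coef_expX0 p k i : p`_0 = 0 -> (i < k)%N -> (p ^+ k)`_i = 0.
Proof.
move=> p0 lt_ik; have /factor_theorem[q ->] : root p 0.
  by rewrite /root horner_coef0 p0.
by rewrite subr0 exprMn coefMXn lt_ik.
Qed.

Lemma fps_expX0 f k i : coef f 0 = 0 -> (i < k)%N -> coef (f ^+ k) i = 0.
Proof.
move=> f0 lt_ik; rewrite -(agree_exp k (@truncP i f)) //.
by rewrite coef_expX0 // truncP.
Qed.

Lemma agree_comp n p q f g : coef g 0 = 0 ->
  agree n p f -> agree n q g -> agree n (p \Po q) (fps_comp f g).
Proof.
move=> g0 pf qg i le_in; have q0 : q`_0 = 0 by rewrite qg.
rewrite coef_comp_poly /=.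
pose F k := p`_k * (q ^+ k)`_i.
have big0 m : (minn (size p) i.+1 <= m)%N ->
    \sum_(k < m) F k = \sum_(k < minn (size p) i.+1) F k.
  move=> le_m; rewrite -!(big_mkord xpredT F) (big_cat_nat _ le_m) //=.
  rewrite [X in _ + X]big_nat [X in _ + X]big1 ?addr0 // => k /andP[+ _].
  rewrite geq_min /F => /orP[lek|lek]; first by rewrite nth_default ?mul0r.
  by rewrite coef_expX0 ?mulr0.
rewrite (big0 (size p)) ?geq_minl // -(big0 i.+1) ?geq_minr //.
apply: eq_bigr => k _; rewrite /F pf ?(agree_exp _ qg) //.
by rewrite (leq_trans _ le_in) // -ltnS.
Qed.

Lemma fps_comp0 f g : coef (fps_comp f g) 0 = coef f 0.
Proof. by rewrite /= big_ord1 expr0 mulr1. Qed.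

Lemma agree_X n : agree n 'X fpsX.
Proof. by move=> i _; rewrite coefX. Qed.

Lemma fps_compXl f : coef f 0 = 0 -> fps_comp fpsX f = f.
Proof.
move=> f0; apply: (@agree_ext _ _ (fun n => 'X \Po trunc n f)) => n.
  by apply: agree_comp => //; [apply: agree_X | apply: truncP].
by rewrite comp_polyX; apply: truncP.
Qed.

Lemma fps_compXr f : fps_comp f fpsX = f.
Proof.
apply: (@agree_ext _ _ (fun n => trunc n f \Po 'X)) => n.
  by apply: agree_comp => //; [apply: truncP | apply: agree_X].
by rewrite comp_polyXr; apply: truncP.
Qed.

Lemma fps_compA f g h : coef g 0 = 0 -> coef h 0 = 0 ->
  fps_comp f (fps_comp g h) = fps_comp (fps_comp f g) h.
Proof.
move=> g0 h0; pose P n := trunc n f \Po (trunc n g \Po trunc n h).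
have gh0 : coef (fps_comp g h) 0 = 0 by rewrite fps_comp0.
apply: (@agree_ext _ _ P) => n; last rewrite /P comp_polyA;
  by do !apply: agree_comp => //; apply: truncP.
Qed.

Lemma fps_compM f g h : coef h 0 = 0 ->
  fps_comp (f * g) h = fps_comp f h * fps_comp g h.
Proof.
move=> h0; pose P n := (trunc n f * trunc n g) \Po trunc n h.
apply: (@agree_ext _ _ P) => n.
  by apply: agree_comp => //; first apply: agree_mul; apply: truncP.
rewrite /P comp_polyM.
by apply: agree_mul; apply: agree_comp => //; apply: truncP.
Qed.

Lemma fps_exp_diag f n : coef f 0 = 0 -> coef (f ^+ n) n = coef f 1 ^+ n.
Proof.
move=> f0; elim: n => [|n IHn] //.
rewrite exprS coefM_fps 2!big_ord_recl /= f0 mul0r add0r subSS subn0 IHn.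
rewrite big1 ?addr0 ?exprS // => i _; rewrite fps_expX0 ?mulr0 //=.
by rewrite /bump /= !add1n !subSS (leq_ltn_trans (n := (n - i.+1)%N)) //
  ltn_subrL (leq_ltn_trans _ (ltn_ord i)).
Qed.

Lemma fps_left_inverse f : coef f 0 = 0 -> coef f 1 != 0 ->
  exists h, [/\ coef h 0 = 0, coef h 1 != 0 & fps_comp h f = fpsX].
Proof.
move=> f0 f1; pose Phi n s :=
  ((n == 1)%:R - \sum_(i < n) nth 0 s i * coef (f ^+ i) n) / coef f 1 ^+ n.
have [x xE] := course_of_values Phi.
have x0 : x 0 = 0 by rewrite xE /Phi big_ord0 subrr mul0r.
exists (Fps x); split => //=.
  rewrite xE /Phi big_ord1 nth_mkseq //= x0 mul0r subr0 mul1r expr1.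
  by rewrite invr_eq0.
apply: fpsP => n /=.
rewrite big_ord_recr /= [x n]xE /Phi fps_exp_diag // divfK ?expf_neq0 //.
rewrite addrC -[RHS]addr0 -addrA; congr (_ + _).
apply/eqP; rewrite addrC subr_eq0; apply/eqP/eq_bigr => i _.
by rewrite nth_mkseq.
Qed.

Lemma fps_revP f :
  coef f 0 = 0 -> coef f 1 != 0 -> is_comp_inverse f (fps_rev f).
Proof.
move=> f0 f1; suff ex : exists h, is_comp_inverse f h.
  by have := xgetPex 0 ex.
have [h [h0 h1 hf]] := fps_left_inverse f0 f1.
have [k [k0 _ kh]] := fps_left_inverse h0 h1.
exists h; split=> //; suff <- : k = f by [].
by rewrite -[LHS]fps_compXr -hf fps_compA // kh fps_compXl.
Qed.

Lemma fps_rev_uniq f h : coef f 0 = 0 -> is_comp_inverse f h -> h = fps_rev f.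
Proof.
move=> f0 hP; have [r0 fr rf] : is_comp_inverse f (fps_rev f).
  by have := xgetPex (0 : fps K) (ex_intro _ h hP).
have [h0 fh hf] := hP.
by rewrite -(fps_compXl r0) -hf -fps_compA // fr fps_compXr.
Qed.

Definition ogf (s : nat -> K) : fps K := Fps s.
Definition egf (s : nat -> K) : fps K := Fps (fun n => s n / n`!%:R).

End FpsRing.

Notation "f \So g" := (fps_comp f g) (at level 50) : ring_scope.

Section Matrices.
Variable K : fieldType.
Implicit Types (u v : nat -> nat -> K) (a : nat -> K).

(* [Mmx u v a n k] is a_n^k, the entry in row k and column n: as for u and v,
   the column index comes first.  The values u(n,0) and v(n,0) are unused. *)
Fixpoint Mmx u v a (n k : nat) : K :=
  if k is k'.+1 then u n k * Mmx u v a n k' + v n k * Mmx u v a n.+1 k'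
  else a n.

(* A subset of [k] = {1, ..., k} is represented by A : {set 'I_k}, where i
   stands for i + 1; [decr A] lists its elements in decreasing order. *)
Definition decr (k : nat) (A : {set 'I_k}) : seq nat :=
  sort geq [seq (val i).+1 | i <- enum A].

(* C_n(k, l). No subtraction is truncated: as h_0 > ... > h_i are elements of
   [k], one has h_i + i <= k. *)
Definition assoc_mx u v (n k l : nat) : K :=
  if (l <= k)%N then
    \sum_(A : {set 'I_k} | #|A| == (k - l)%N)
      (\prod_(i < k - l) (let h := nth 0%N (decr A) i in
                          u (n + k - h - i)%N h)) *
      (\prod_(j < l) (let m := nth 0%N (decr (~: A)) j in
                      v (n + j)%N m))
  else 0.

(* The coefficients u', v' of the transpose, see [Mmx_tr]. *)
Definition tr_u u v (n k : nat) : K := - (u k.-1 n.+1 / v k.-1 n.+1).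
Definition tr_v v (n k : nat) : K := (v k.-1 n.+1)^-1.

Lemma Mmx_tr u v a (v_neq0 : forall n k, (0 < k)%N -> v n k != 0) n k :
  Mmx (tr_u u v) (tr_v v) (Mmx u v a 0) n k = Mmx u v a k n.
Proof.
elim: k n => [|k IHk] n //; rewrite [LHS]/= !IHk /tr_u /tr_v /=.
rewrite mulrDr mulKf ?v_neq0 // addrA [_^-1 * _]mulrCA mulNr -!mulrA.
by rewrite addNr add0r.
Qed.

(* The product of two lower triangular matrices: all terms with j > k vanish. *)
Definition ltmul (A B : nat -> nat -> K) (k l : nat) : K :=
  \sum_(j < k.+1) A k j * B j l.

Definition is_ltinverse (A B : nat -> nat -> K) : Prop :=
  forall k l, ltmul A B k l = (k == l)%:R /\ ltmul B A k l = (k == l)%:R.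

End Matrices.

(* Main.v *)
(* Splitting the subsets A of [k+1] according to whether k+1 belongs to A shows
   that column 0 is R applied to row 0.  The transpose exchanges column 0 and
   row 0, and transposing twice gives back M, so its associated matrix undoes R
   on every sequence; sequences with a single nonzero entry then give the
   inverse matrix.
   When R is a (weighted) Riordan matrix, the relation between row 0 and column
   0 reads b = g * (s o f), with b the generating function of column 0 and s the
   suitably weighted one of row 0; substituting the compositional inverse of f
   solves this for s. *)
Require Import Defs.
From mathcomp Require Import all_boot all_order all_algebra.
From mathcomp Require Import reals complex.

Set Implicit Arguments.
Unset Strict Implicit.
Unset Printing Implicit Defensive.

Import GRing.Theory.
Local Open Scope ring_scope.

(** * Subsets of [k], the associated matrix and the double transpose *)

Section AssociatedMatrix.
Variable K : fieldType.
Implicit Types (u v : nat -> nat -> K) (a : nat -> K).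

Lemma mem_decr k (A : {set 'I_k}) x :
  (x \in decr A) = (x \in [seq (val i).+1 | i <- enum A]).
Proof. by rewrite mem_sort. Qed.

(** Strictness lets [irr_sorted_eq] reduce equality of such lists to equality of their members. *)
Lemma decr_sorted k (A : {set 'I_k}) : sorted gtn (decr A).
Proof.
rewrite gtn_sorted_uniq_geq sort_uniq sort_sorted ?andbT; last first.
  by move=> x y; apply: leq_total.
by rewrite map_inj_uniq ?enum_uniq // => x y [/val_inj].
Qed.

(** [lift ord_max] is the inclusion of [k] into [k+1]: it preserves values, and [ord_max] stands for
    k+1. *)
Lemma decr_lift k (B : {set 'I_k}) : decr (lift ord_max @: B) = decr B.
Proof.
apply: (irr_sorted_eq (leT := gtn)); rewrite ?decr_sorted //.
- by move=> x y z xy yz; apply: ltn_trans yz xy.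
- exact: ltnn.
move=> x; rewrite !mem_decr; apply/mapP/mapP => -[y].
  rewrite mem_enum => /imsetP[z zB ->] ->; exists z; rewrite ?mem_enum //.
  by rewrite [val _]lift_max.
rewrite mem_enum => yB ->; exists (lift ord_max y).
  by rewrite mem_enum imset_f.
by rewrite [val (lift _ _)]lift_max.
Qed.

Lemma decr_max k (B : {set 'I_k}) :
  decr (ord_max |: lift ord_max @: B) = k.+1 :: decr B.
Proof.
apply: (irr_sorted_eq (leT := gtn)).
- by move=> x y z xy yz; apply: ltn_trans yz xy.
- exact: ltnn.
- exact: decr_sorted.
- rewrite /= path_min_sorted ?decr_sorted //; apply/allP => x.
  by rewrite mem_decr => /mapP[y _ ->]; rewrite /= ltnS.
move=> x; rewrite in_cons -(decr_lift B) !mem_decr.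
apply/mapP/orP => [[y]|[/eqP->|/mapP[y]]].
- rewrite mem_enum in_setU1 => /orP[/eqP-> ->|yB ->]; [by left|right].
  by apply/mapP; exists y; rewrite ?mem_enum.
- by exists ord_max; rewrite ?mem_enum ?setU11.
- rewrite mem_enum => yB ->; exists y => //.
  by rewrite mem_enum in_setU1 yB orbT.
Qed.

Lemma max_notin_lift k (B : {set 'I_k}) : ord_max \notin lift ord_max @: B.
Proof. by apply/imsetP => -[i _ /eqP]; rewrite (negPf (neq_lift _ _)). Qed.

Lemma preim_lift_imset k (B : {set 'I_k}) :
  lift ord_max @^-1: (lift ord_max @: B) = B.
Proof. by apply/setP => i; rewrite inE mem_imset //; apply: lift_inj. Qed.

Lemma preim_lift_max k (B : {set 'I_k}) :
  lift ord_max @^-1: (ord_max |: lift ord_max @: B) = B.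
Proof.
apply/setP => i; rewrite !inE mem_imset; last exact: lift_inj.
by rewrite eq_sym (negPf (neq_lift _ _)).
Qed.

Lemma lift_preimK k (A : {set 'I_k.+1}) :
  lift ord_max @: (lift ord_max @^-1: A) = A :\ ord_max.
Proof.
apply/setP => i; rewrite !inE; case: (unliftP ord_max i) => [j ->|->].
  rewrite mem_imset ?inE; last exact: lift_inj.
  by rewrite eq_sym neq_lift.
by rewrite eqxx (negPf (max_notin_lift _)).
Qed.

Lemma setC_lift k (B : {set 'I_k}) :
  ~: (lift ord_max @: B) = ord_max |: lift ord_max @: (~: B).
Proof.
apply/setP => i; rewrite !inE; case: (unliftP ord_max i) => [j ->|->].
  rewrite !mem_imset ?inE; try exact: lift_inj.
  by rewrite eq_sym (negPf (neq_lift _ _)).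
by rewrite eqxx max_notin_lift.
Qed.

Lemma setC_max k (B : {set 'I_k}) :
  ~: (ord_max |: lift ord_max @: B) = lift ord_max @: (~: B).
Proof. by rewrite -[B in LHS]setCK -setC_lift setCK. Qed.

(** Taking the preimage under [lift ord_max] forgets k+1, which inverts both ways of extending B to
    a subset of [k+1]. *)
Lemma sum_set_ordS k (F : {set 'I_k.+1} -> K) :
  \sum_A F A = \sum_(B : {set 'I_k}) F (ord_max |: lift ord_max @: B)
             + \sum_(B : {set 'I_k}) F (lift ord_max @: B).
Proof.
rewrite (bigID (fun A : {set 'I_k.+1} => ord_max \in A)) /=; congr (_ + _).
  rewrite (reindex_onto (fun B : {set 'I_k} => ord_max |: lift ord_max @: B)
    (fun A => lift ord_max @^-1: A)) /=; last first.
    by move=> A Amax; rewrite lift_preimK setD1K.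
  by apply: eq_bigl => B; rewrite setU11 preim_lift_max eqxx.
rewrite (reindex_onto (fun B : {set 'I_k} => lift ord_max @: B)
  (fun A => lift ord_max @^-1: A)) /=; last first.
  move=> A Amax; rewrite lift_preimK; apply/setP => i; rewrite !inE.
  by case: eqP => // ->; rewrite (negPf Amax).
by apply: eq_bigl => B; rewrite max_notin_lift preim_lift_imset eqxx.
Qed.

(** The summand of C_n(k, l), with both lengths read off A, so that subsets of all sizes can be
    summed together. *)
Definition weight u v n k (A : {set 'I_k}) : K :=
  (\prod_(i < #|A|) (let h := nth 0%N (decr A) i in u (n + k - h - i)%N h)) *
  (\prod_(j < #|~: A|) (let m := nth 0%N (decr (~: A)) j in v (n + j)%N m)).

(** Here h_0 = k+1 contributes u(n, k+1). Each other h moves one place down the list, which cancels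
    the increase of k in n + k - h - i. *)
Lemma weight_max u v n k (B : {set 'I_k}) :
  weight u v n (ord_max |: lift ord_max @: B) = u n k.+1 * weight u v n B.
Proof.
rewrite /weight setC_max decr_lift decr_max.
rewrite cardsU1 max_notin_lift !card_imset; try exact: lift_inj.
rewrite add1n big_ord_recl /= subn0 addnK -mulrA; congr (_ * (_ * _)).
by apply: eq_bigr => i _; rewrite /bump /= add1n addnS subnAC !subSS subnAC.
Qed.

(** Here m_0 = k+1 contributes v(n, k+1). The shift of j in the v factors and the increase of k in
    the u factors both turn n into n+1. *)
Lemma weight_lift u v n k (B : {set 'I_k}) :
  weight u v n (lift ord_max @: B) = v n k.+1 * weight u v n.+1 B.
Proof.
rewrite /weight setC_lift decr_lift decr_max.
rewrite cardsU1 max_notin_lift !card_imset; try exact: lift_inj.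
rewrite add1n big_ord_recl /= addn0 mulrCA; congr (_ * (_ * _)).
  by apply: eq_bigr => i _; rewrite addnS.
by apply: eq_bigr => i _; rewrite /bump /= add1n addnS.
Qed.

(** By induction on k: the subsets containing k+1 give the u term of the recurrence, the others give
    the v term. *)
Lemma Mmx_weight u v a n k :
  Mmx u v a n k = \sum_(A : {set 'I_k}) weight u v n A * a (n + #|~: A|)%N.
Proof.
elim: k n => [|k IHk] n /=.
  have set0E (A : {set 'I_0}) : A = set0 by apply/setP => -[].
  rewrite (big_pred1 set0) => [|A]; last by rewrite (set0E A) /= eqxx.
  by rewrite /weight (set0E (~: _)) cards0 !big_ord0 !mul1r addn0.
rewrite !IHk sum_set_ordS !big_distrr; congr (_ + _); apply: eq_bigr => B _.
  by rewrite weight_max setC_max card_imset -?mulrA //; apply: lift_inj.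
rewrite weight_lift setC_lift cardsU1 max_notin_lift card_imset -?mulrA.
  by rewrite add1n addnS.
exact: lift_inj.
Qed.

Lemma assoc_mx_weight u v n k l :
  assoc_mx u v n k l = \sum_(A : {set 'I_k} | #|~: A| == l) weight u v n A.
Proof.
have cardA (A : {set 'I_k}) : (#|A| + #|~: A|)%N = k by rewrite cardsC card_ord.
rewrite /assoc_mx; case: leqP => [le_lk|lt_kl]; last first.
  rewrite big_pred0 // => A; apply/negbTE.
  by rewrite neq_ltn (leq_ltn_trans _ lt_kl) // -[leqRHS](cardA A) leq_addl.
apply: eq_big => [A|A /eqP Ak].
  by rewrite -(eqn_add2r #|~: A|) cardA -(eqn_add2l (k - l) _ l) subnK // eq_sym.
rewrite /weight.
suff -> : #|~: A| = l by rewrite Ak.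
by apply/eqP; rewrite -(eqn_add2l #|A|) cardA Ak subnK.
Qed.

(** Grouping the subsets A by the size l of their complement collects the coefficient of a(n +
    l). *)
Lemma Mmx_assoc u v a n k :
  Mmx u v a n k = \sum_(l < k.+1) assoc_mx u v n k l * a (n + l)%N.
Proof.
have ltA (A : {set 'I_k}) : (#|~: A| < k.+1)%N.
  by rewrite ltnS -[k in leqRHS]card_ord max_card.
rewrite Mmx_weight (partition_big (fun A => Ordinal (ltA A)) xpredT) //=.
apply: eq_bigr => l _; rewrite assoc_mx_weight big_distrl /=.
by apply: eq_big => // A /eqP <-.
Qed.

(** Agreement is asked at positive row indices only, since transposing the coefficients twice gives
    u(n, 1) and v(n, 1) at k = 0. *)
Lemma eq_Mmx u v u' v' a n k :
  (forall n k, u n k.+1 = u' n k.+1) -> (forall n k, v n k.+1 = v' n k.+1) ->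
  Mmx u v a n k = Mmx u' v' a n k.
Proof. by move=> uE vE; elim: k n => //= k IHk n; rewrite uE vE !IHk. Qed.

Lemma Mmx_trtr u v a (v_neq0 : forall n k, (0 < k)%N -> v n k != 0) n k :
  Mmx u v (Mmx (tr_u u v) (tr_v v) a 0) n k = Mmx (tr_u u v) (tr_v v) a k n.
Proof.
rewrite -[RHS]Mmx_tr => [|i j j_gt0]; last by rewrite invr_eq0 v_neq0.
apply: eq_Mmx => i j; rewrite /tr_u /tr_v /= invrK //.
by rewrite mulNr opprK divfK ?v_neq0.
Qed.

(** Column l of the second matrix is its action on the l-th unit sequence, hence column 0 of the
    matrix M started from that sequence; the first matrix then acts on it in the same way. *)
Lemma ltmul_assoc u v u' v' k l :
  ltmul (assoc_mx u v 0) (assoc_mx u' v' 0) k l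
  = Mmx u v (Mmx u' v' (fun i => (i == l)%:R) 0) 0 k.
Proof.
rewrite Mmx_assoc; apply: eq_bigr => j _; congr (_ * _).
rewrite add0n Mmx_assoc; under eq_bigr do rewrite add0n.
(* If l <= j, only the term i = l survives; if l > j, the entry is 0 by triangularity and the sum
   stops before l. *)
case: (ltnP l j.+1) => [lt_lj|lt_jl].
  rewrite (bigD1 (Ordinal lt_lj)) //= eqxx mulr1 big1 ?addr0 // => i neq_il.
  by rewrite (negPf neq_il : (i == l :> nat) = false) mulr0.
rewrite {1}/assoc_mx leqNgt lt_jl /= big1 // => i _.
by rewrite ltn_eqF ?mulr0 // (leq_trans (ltn_ord i)).
Qed.

Lemma assoc_tr_inverse u v :
  (forall n k, (0 < k)%N -> v n k != 0) ->
  is_ltinverse (assoc_mx u v 0) (assoc_mx (tr_u u v) (tr_v v) 0).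
Proof. by move=> v_neq0 k l; rewrite !ltmul_assoc Mmx_trtr ?Mmx_tr. Qed.

End AssociatedMatrix.

(** * Riordan matrices acting on power series *)

Section RiordanAction.
Variable K : fieldType.
Implicit Types (f g s b : fps K).

Lemma coef_mulZ (c : K) f g n : coef (f * (c *: g)) n = c * coef (f * g) n.
Proof.
by rewrite !coefM_fps big_distrr; apply: eq_bigr => i _; rewrite mulrCA.
Qed.

Lemma coef_mul_comp g s f n : coef f 0 = 0 ->
  coef (g * (s \So f)) n = \sum_(l < n.+1) coef s l * coef (g * f ^+ l) n.
Proof.
move=> f0; under [RHS]eq_bigr do rewrite coefM_fps big_distrr.
rewrite exchange_big coefM_fps; apply: eq_bigr => /= i _.
(* The composition stops at l = n - i; the range extends to n because f^l has order at least l. *)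
rewrite big_distrr /= (big_ord_widen n.+1
  (fun l => coef g i * (coef s l * coef (f ^+ l) (n - i)))) ?ltnS ?leq_subr //.
rewrite big_mkcond /=; apply: eq_bigr => l _; rewrite mulrCA.
by case: ltnP => // lt_l; rewrite fps_expX0 ?mulr0.
Qed.

Lemma riordan_inverse g f s b :
  coef g 0 != 0 -> coef f 0 = 0 -> coef f 1 != 0 ->
  (forall n, coef b n = \sum_(l < n.+1) coef s l * coef (g * f ^+ l) n) ->
  (g \So fps_rev f)^-1 * (b \So fps_rev f) = s.
Proof.
move=> g0 f0 f1 bE; have [r0 fr _] := fps_revP f0 f1.
have -> : b = g * (s \So f) by apply: fpsP => n; rewrite coef_mul_comp.
rewrite fps_compM // -fps_compA // fr fps_compXr mulKr //.
by rewrite fps_unitE fps_comp0.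
Qed.

End RiordanAction.

Theorem theorem17 (R : realType) (u v : nat -> nat -> R[i]) (a : nat -> R[i])
    (v_neq0 : forall n k : nat, (0 < k)%N -> v n k != 0) :
  let r : nat -> nat -> R[i] := assoc_mx u v 0 in
  let a0 : nat -> R[i] := fun k => Mmx u v a 0 k in
  [/\ is_ltinverse r (assoc_mx (tr_u u v) (tr_v v) 0),
      forall (g f : fps R[i]) (w : nat -> R[i]),
        coef g 0 = 1 -> coef f 0 = 0 -> coef f 1 != 0 ->
        (forall l : nat, ogf (fun k => r k l) = w l *: (g * f ^+ l)) ->
        ((forall l : nat, w l = 1) ->
           (g \So fps_rev f)^-1 * (ogf a0 \So fps_rev f) = ogf a) /\
        ((forall l : nat, w l = (l`!%:R)^-1) ->
           (g \So fps_rev f)^-1 * (ogf a0 \So fps_rev f) = egf a)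
    & forall (G F : fps R[i]) (w : nat -> R[i]),
        coef G 0 = 1 -> coef F 0 = 0 -> coef F 1 != 0 ->
        (forall l : nat,
           egf (fun k => r k l) = w l *: (G * ((l`!%:R)^-1 *: F ^+ l))) ->
        ((forall l : nat, w l = 1) ->
           (G \So fps_rev F)^-1 * (egf a0 \So fps_rev F) = egf a) /\
        ((forall l : nat, w l = l`!%:R) ->
           (G \So fps_rev F)^-1 * (egf a0 \So fps_rev F) = ogf a)].
Proof.
move=> r a0.
have a0E k : a0 k = \sum_(l < k.+1) r k l * a l by apply: Mmx_assoc.
split; first exact: assoc_tr_inverse.
- move=> g f w g0 f0 f1 rE.
  have{}rE k l : r k l = w l * coef (g * f ^+ l) k.
    by have /(congr1 (coef^~ k)) := rE l.
  (* Moving w_l from the columns to row 0 leaves an unweighted Riordan matrix; the two choices of w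
     make s the ordinary or the exponential series of a. *)
  have main s : (forall l, coef s l = a l * w l) ->
      (g \So fps_rev f)^-1 * (ogf a0 \So fps_rev f) = s.
    move=> sE; apply: riordan_inverse; rewrite ?g0 ?oner_eq0 // => n.
    by rewrite /= a0E; apply: eq_bigr => l _; rewrite rE sE mulrC mulrA.
  by split=> wE; apply: main => l; rewrite wE ?mulr1.
- move=> G F w G0 F0 F1 rE.
  have{}rE k l : r k l / k`!%:R = w l / l`!%:R * coef (G * F ^+ l) k.
    have /(congr1 (coef^~ k)) := rE l.
    by rewrite coefZ_fps coef_mulZ mulrA.
  (* The effective weight is now w_l / l!, so w_l = 1 gives the exponential series and w_l = l! the
     ordinary one. *)
  have main s : (forall l, coef s l = a l * (w l / l`!%:R)) ->
      (G \So fps_rev F)^-1 * (egf a0 \So fps_rev F) = s.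
    move=> sE; apply: riordan_inverse; rewrite ?G0 ?oner_eq0 // => n.
    rewrite /= a0E big_distrl; apply: eq_bigr => l _ /=.
    by rewrite mulrAC rE sE mulrC -[RHS]mulrA.
  split=> wE; apply: main => l; rewrite wE ?mul1r // divff ?mulr1 //.
  by rewrite Num.Theory.pnatr_eq0 -lt0n fact_gt0.
Qed.
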